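(* Let $d\in\mathbb N$, $k\in\mathbb N\setminus\{1\}$, $\bm\rho\in\mathbb N^d$, $X=X(\bm\rho)$, $\Omega=\Omega(\bm\rho)$, let $\mathrm K=\{\kappa_1,\ldots,\kappa_k\}$ be a family of positive integer multiples of $\nu(\bm\rho)$ with $\sum_{i=1}^k\kappa_i=1$, and let $\epsilon\in(0,\frac12]$. Then there is an $\epsilon$-resolution coreset $(\tilde X,\tilde\Omega)$ for $(k,X,\Omega,\mathrm K)$ of size $$|\tilde X|\le 2^{\frac83 d}\left(\frac{k}{\epsilon^{2/3}}\right)^d .$$
   Context: $\mathbb N=\{1,2,\ldots\}$, $[\ell]=\{1,\ldots,\ell\}$; vector inequalities are componentwise. Resolution sets. For $\bm\rho=(\rho_1,\ldots,\rho_d)\in\mathbb N^d$, $X(\bm\rho)\subset[0,1]^d$ is the set of the $n=2^{\rho_1+\cdots+\rho_d}$ points $x_{j_1,\ldots,j_d}$ with $t$th coordinate $\frac{1}{2^{\rho_t+1}}+\frac{j_t-1}{2^{\rho_t}}$, $j_t\in[2^{\rho_t}]$, $t\in[d]$, and $\nu(\bm\rho)=2^{-\rho_1}\cdots2^{-\rho_d}$. $\Omega(\bm\rho)$ assigns weight $\nu(\bm\rho)$ to each point of $X(\bm\rho)$. Clusterings. For a weighted set $(X,\Omega)$ of points $x_1,\ldots,x_n\in\mathbb R^d$ with weights $\omega_1,\ldots,\omega_n>0$, a $k$-clustering is a vector $C=(C_1,\ldots,C_k)=(\xi_{ij})_{i\in[k],j\in[n]}\in[0,1]^{kn}$ with $\sum_{i=1}^k\xi_{ij}=1$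 for all $j$ ($\xi_{ij}$ is the fraction of $x_j$ assigned to cluster $i$). $\mathcal C_{\mathrm K}(k,X,\Omega)$ is the set of $k$-clusterings with $\sum_{j}\xi_{ij}\omega_j=\kappa_i$ for all $i\in[k]$. Costs. For a set $S=\{s_1,\ldots,s_k\}\subset\mathbb R^d$ of $k$ (different, indexed) sites, $\mathrm{cost}(X,C,S)=\sum_{i=1}^k\sum_{j=1}^n\xi_{ij}\omega_j\|x_j-s_i\|_2^2$ and $\mathrm{cost}(X,S)=\min\{\mathrm{cost}(X,C,S):C\in\mathcal C_{\mathrm K}(k,X,\Omega)\}$. The same notation is used for $(\tilde X,\tilde\Omega)$. Coresets. $(\tilde X,\tilde\Omega)$ is an $\epsilon$-coreset for $(k,X,\Omega,\mathrm K)$ if there are a mapping $g:\mathcal C_{\mathrm K}(k,\tilde X,\tilde\Omega)\to\mathcal C_{\mathrm K}(k,X,\Omega)$ (called extension) and a real constant $\Delta\ge0$ such that for all sets $S$ of $k$ sites and all $\tilde C\in\mathcal C_{\mathrm K}(k,\tilde X,\tilde\Omega)$: (a) $(1-\epsilon)\,\mathrm{cost}(X,g(\tilde C),S)\le\mathrm{cost}(\tilde X,\tilde C,S)+\Delta$, and (b) $\mathrm{cost}(\tilde X,S)+\Delta\le(1+\epsilon)\,\mathrm{cost}(X,S)$. It is an $\epsilon$-resolution coreset if in addition there is $\bm\tau\in\mathbb N^d$, $\bm\tau\le\bm\rho$, with $\tilde X=X(\bm\tau)$ and $\tilde\Omega=\Omega(\bm\tau)$ (each point has weight $\nu(\bm\tau)$).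 *)

(* Defs.v *)
From HB Require Import structures.
From mathcomp Require Import all_boot all_order all_algebra.
From mathcomp Require Import all_classical all_reals all_analysis.

Set Implicit Arguments.
Unset Strict Implicit.
Unset Printing Implicit Defensive.

Import Order.TTheory GRing.Theory Num.Theory.
Import numFieldNormedType.Exports.

Local Open Scope classical_set_scope.
Local Open Scope ring_scope.

(* A finite weighted set in R^d: distinct points [wpt j] with weights [wwt j],
   indexed by an arbitrary finite type instead of an initial segment of nat.  *)
Record wset (R : realType) (d : nat) := WSet {
  widx :> finType;
  wpt : widx -> 'rV[R]_d;
  wwt : widx -> R;
  wpt_inj : injective wpt;
  wwt_gt0 : forall j, 0 < wwt j
}.

(* The squared Euclidean norm; the library norm on row vectors is the sup norm. *)
Definition sqnorm (R : realType) (d : nat) (x : 'rV[R]_d) : R :=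
  \sum_(t < d) x 0 t ^+ 2.

Definition resolution_weight (R : realType) (d : nat) (rho : 'I_d -> nat) : R :=
  \prod_(t < d) (2 ^+ rho t)^-1.

(* Grid indices count from 0: [j t] stands for j_t - 1. *)
Definition grid_index (d : nat) (rho : 'I_d -> nat) : finType :=
  {dffun forall t : 'I_d, 'I_(2 ^ rho t)}.

Definition grid_point (R : realType) (d : nat) (rho : 'I_d -> nat)
    (j : grid_index rho) : 'rV[R]_d :=
  \row_t ((2 ^+ (rho t).+1)^-1 + (j t)%:R / 2 ^+ rho t).

Lemma grid_point_inj (R : realType) (d : nat) (rho : 'I_d -> nat) :
  injective (@grid_point R d rho).
Proof.
move=> i j /rowP eij; apply/ffunP => t; apply/val_inj.
have := eij t; rewrite !mxE => /addrI /mulIf.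
by rewrite invr_eq0 expf_eq0 pnatr_eq0 andbF => /(_ isT)/eqP; rewrite eqr_nat => /eqP.
Qed.

Lemma resolution_weight_gt0 (R : realType) (d : nat) (rho : 'I_d -> nat) :
  0 < resolution_weight R rho.
Proof. by apply: prodr_gt0 => t _; rewrite invr_gt0 exprn_gt0. Qed.

Definition resolution_set (R : realType) (d : nat) (rho : 'I_d -> nat) :
    wset R d :=
  WSet (@grid_point_inj R d rho) (fun=> resolution_weight_gt0 R rho).

Definition clusterings (R : realType) (d k : nat) (kappa : 'I_k -> R)
    (W : wset R d) : set ('I_k -> W -> R) :=
  [set C | [/\ forall i j, 0 <= C i j <= 1,
               forall j, \sum_(i < k) C i j = 1
             & forall i, \sum_(j : W) C i j * wwt j = kappa i]].

Arguments clusterings {R d k} kappa W.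

Definition clustering_cost (R : realType) (d k : nat) (W : wset R d)
    (C : 'I_k -> W -> R) (s : 'I_k -> 'rV[R]_d) : R :=
  \sum_(i < k) \sum_(j : W) C i j * wwt j * sqnorm (wpt j - s i).

(* The infimum is a minimum whenever there is a clustering at all: see
   [min_cost_attained]. *)
Definition min_cost (R : realType) (d k : nat) (kappa : 'I_k -> R)
    (W : wset R d) (s : 'I_k -> 'rV[R]_d) : R :=
  inf [set clustering_cost C s | C in clusterings kappa W].

Lemma lincomb_continuous (R : realType) (T : topologicalType) (I : finType)
    (F : I -> T -> R) (a : I -> R) :
  (forall i, continuous (F i)) -> continuous (fun f => \sum_(i : I) F i f * a i).
Proof.
move=> cF; apply: (@continuous_big R I +%R 0 xpredT) => [|i _ f].
  exact: pseudometric_normed_Zmodule.add_continuous.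
by apply: cvgM; [exact: cF|exact: cvg_cst].
Qed.

Lemma min_cost_attained (R : realType) (d k : nat) (kappa : 'I_k -> R)
    (W : wset R d) (s : 'I_k -> 'rV[R]_d) :
  clusterings kappa W !=set0 ->
  exists2 C, clusterings kappa W C &
    clustering_cost C s = min_cost kappa W s /\
    forall C', clusterings kappa W C' ->
      clustering_cost C s <= clustering_cost C' s.
Proof.
move=> [C0 C0K].
pose T := prod_topology (fun _ : 'I_k * W => R).
pose A : set T := [set f | clusterings kappa W (fun i j => f (i, j))].
have evalC p : continuous (fun f : T => f p).
  exact: (@proj_continuous _ (fun _ : 'I_k * W => R) p).
have cA : compact A.
  have -> : A =
      [set f : T | forall p, `[0, 1]%classic (f p)] `&`
      (\bigcap_(j in setT) [set f : T | \sum_(i < k) f (i, j) * 1 = 1] `&`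
       \bigcap_(i in setT)
         [set f : T | \sum_(j : W) f (i, j) * wwt j = kappa i]).
    apply/seteqP; split => f.
      move=> [f01 f1 fK]; split=> [[i j]|]; first by rewrite /= in_itv/= f01.
      split=> [j _|i _] /=; last exact: fK.
      by under eq_bigr do rewrite mulr1; exact: f1.
    move=> [f01 [f1 fK]]; split=> [i j|j|i]; last exact: fK.
      by have := f01 (i, j); rewrite /= in_itv.
    by rewrite -(f1 j I); under [RHS]eq_bigr do rewrite mulr1.
  apply: compact_closedI.
    apply: (@tychonoff _ (fun _ : 'I_k * W => R) (fun=> `[0, 1]%classic)) => p.
    exact: segment_compact.
  apply: closedI; apply: closed_bigI => i _.
    apply: (@closed_comp _ _ (fun f : T => \sum_(l < k) f (l, i) * 1) [set 1]).
      move=> f _.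
      exact: (@lincomb_continuous R T _ (fun l f => f (l, i)) (fun=> 1)).
    exact: closed_eq.
  apply: (@closed_comp _ _ (fun f : T => \sum_(j : W) f (i, j) * wwt j)
            [set kappa i]).
    move=> f _.
    exact: (@lincomb_continuous R T _ (fun j f => f (i, j)) (@wwt _ _ W)).
  exact: closed_eq.
pose F (f : T) := clustering_cost (fun i j => f (i, j)) s.
have cF : continuous F.
  have -> : F = fun f : T => \sum_(p : 'I_k * W)
      f p * (wwt p.2 * sqnorm (wpt p.2 - s p.1)).
    apply/funext => f; rewrite /F /clustering_cost pair_bigA /=.
    by apply: eq_bigr => -[i j] _ /=; rewrite mulrA.
  exact: (@lincomb_continuous R T _ (fun p f => f p)
            (fun p : 'I_k * W => wwt p.2 * sqnorm (wpt p.2 - s p.1))).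
have A0 : A !=set0 by exists (fun p => C0 p.1 p.2).
have [c /set_mem cK cmin] :=
  compact_EVT_min A0 cA (continuous_subspaceT cF).
have le_c C' : clusterings kappa W C' ->
    clustering_cost (fun i j => c (i, j)) s <= clustering_cost C' s.
  by move=> CK'; apply: (cmin (fun p => C' p.1 p.2)); rewrite inE.
exists (fun i j => c (i, j)) => //; split=> //.
apply/eqP; rewrite eq_le; apply/andP; split.
  by apply: lb_le_inf => [|_ [C' CK' <-]]; [eexists; exists C0|exact: le_c].
apply: ge_inf; last by exists (fun i j => c (i, j)).
by exists (F c) => _ [C' CK' <-]; exact: le_c.
Qed.

(* The k different sites are an injective family [s]; the extension is a total
   function [g] of which only the restriction to clusterings matters. *)
Definition is_coreset (R : realType) (d k : nat) (eps : R) (kappa : 'I_k -> R)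
    (W W' : wset R d) : Prop :=
  exists (g : ('I_k -> W' -> R) -> ('I_k -> W -> R)) (Delta : R),
    [/\ set_fun (clusterings kappa W') (clusterings kappa W) g,
        0 <= Delta
      & forall (s : 'I_k -> 'rV[R]_d) (C : 'I_k -> W' -> R),
          injective s -> clusterings kappa W' C ->
          (1 - eps) * clustering_cost (g C) s <= clustering_cost C s + Delta /\
          min_cost kappa W' s + Delta <= (1 + eps) * min_cost kappa W s].

Definition is_resolution_coreset (R : realType) (d k : nat) (eps : R)
    (kappa : 'I_k -> R) (rho : 'I_d -> nat) (W' : wset R d) : Prop :=
  is_coreset eps kappa (resolution_set R rho) W' /\
  exists tau : 'I_d -> nat,
    (forall t, (0 < tau t <= rho t)%N) /\ W' = resolution_set R tau.

(* Main.v *)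
Require Import Defs.
From mathcomp Require Import all_boot all_order all_algebra.
From mathcomp Require Import all_classical all_reals all_analysis.
From mathcomp Require Import ring lra zify.

Import Order.TTheory GRing.Theory Num.Theory.
Local Open Scope ring_scope.

Set Implicit Arguments.
Unset Strict Implicit.
Unset Printing Implicit Defensive.

(** Merge the fine grid into a coarser dyadic one: every fine point moves to the
    center of its coarse cell, which is also the centroid of the fine points in
    that cell. With [Delta] the total weighted squared
    displacement and with the extension that gives all points of a cell the
    fractions of their center, the parallel axis identity makes condition (a) an
    equality without the factor [1 - eps] ([pull_clustering_cost]).

    For (b), average an optimal fine clustering over the cells. By the same
    identity this changes the cost, up to [Delta], by the cross terms
    2 * sum of xi_ij * w_j * <x_j - center, s_i>, and it remains to see that
    they are at most [eps] times the cost ([merging_coreset]). Cost and cross terms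
    both split over the coordinates [t], and for fixed [t] over the grid lines
    parallel to the [t]-th axis, so that a one-dimensional estimate suffices
    ([line_error]), on a line with N fine points and M = 2^m coarse cells.

    - Exchanging mass between two points of a line cannot lower the optimal
      cost, so along the line the [t]-th coordinates of the sites in use are
      nondecreasing ([exchange_optimal]). Hence at most [k] cells of the line
      use sites with different [t]-th coordinates ([card_split_block]). The
      other cells contribute nothing, as displacements in a cell sum to zero.
    - In a remaining cell, measure the site from the point that is assigned to it
      and apply the inequality between the arithmetic and the geometric mean to
      the displacement and the distance ([block_error]). The contribution is at
      most eps/2 times the cost of the cell plus O(1/eps) times the sum of the
      squared displacements, and the latter sums to O(k / M^3) over the at most
      [k] cells of a line of mass 1.
    - Whatever the clustering, [k] numbers are a poor quantizer of N >= 10 k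
      equidistant points: the cost of a line of mass 1 is at least 1/(40 k^2)
      ([quantization_bound]).

    So the error is at most eps * cost as soon as M^3 * eps^2 is at least a
    constant times k^3, which is where the exponent 2/3 of [eps] comes from. The
    largest m with 2^m <= 2^(8/3) k / eps^(2/3) satisfies
    M^3 * eps^2 >= 32 k^3, and this suffices. A coordinate in which the given
    grid has resolution at most m is not coarsened and has no error. *)

(** * Merging weighted points into their centroids *)

(** The second condition says that each point of [W'] is the centroid of its
    fiber. *)
Definition merging (R : realType) (d : nat) (W W' : wset R d) (p : W -> W') :=
  (forall q, \sum_(j | p j == q) wwt j = wwt q) /\
  (forall q t, \sum_(j | p j == q) wwt j * (wpt j 0 t - wpt q 0 t) = 0).

Definition merging_spread (R : realType) (d : nat) (W W' : wset R d)
    (p : W -> W') : R :=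
  \sum_(j : W) wwt j * sqnorm (wpt j - wpt (p j)).

Definition push_clustering (R : realType) (d k : nat) (W W' : wset R d)
    (p : W -> W') (C : 'I_k -> W -> R) : 'I_k -> W' -> R :=
  fun i q => (wwt q)^-1 * \sum_(j | p j == q) C i j * wwt j.

(** The cross term, in coordinate [t], of the parallel axis identity
    [clustering_cost_merged]. The vector [wpt (p j)] is not subtracted from the
    site because that part cancels in each fiber. *)
Definition merging_error (R : realType) (d k : nat) (W W' : wset R d)
    (p : W -> W') (C : 'I_k -> W -> R) (s : 'I_k -> 'rV[R]_d) (t : 'I_d) : R :=
  2 * \sum_(i < k) \sum_(j : W)
    C i j * wwt j * (wpt j 0 t - wpt (p j) 0 t) * s i 0 t.

Lemma sum_fibers (R : realType) (I J : finType) (p : I -> J) (F : J -> I -> R) :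
  \sum_(j : J) \sum_(i | p i == j) F j i = \sum_(i : I) F (p i) i.
Proof.
rewrite (partition_big p xpredT) //=.
by apply: eq_bigr => q _; apply: eq_bigr => i /eqP ->.
Qed.

(** The upper bounds on the fractions follow from the other conditions. *)
Lemma clusteringsI (R : realType) (d k : nat) (kappa : 'I_k -> R)
    (W : wset R d) (C : 'I_k -> W -> R) :
  (forall i j, 0 <= C i j) -> (forall j, \sum_(i < k) C i j = 1) ->
  (forall i, \sum_(j : W) C i j * wwt j = kappa i) -> clusterings kappa W C.
Proof.
move=> C0 C1 CK; split=> // i j; rewrite C0 /= -(C1 j) (bigD1 i) //= lerDl.
by apply: sumr_ge0.
Qed.

Section Merging.
Variables (R : realType) (d k : nat) (kappa : 'I_k -> R) (W W' : wset R d).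
Variables (p : W -> W') (mp : merging p).

Lemma pull_clustering (C : 'I_k -> W' -> R) :
  clusterings kappa W' C -> clusterings kappa W (fun i j => C i (p j)).
Proof.
move=> [C01 C1 CK]; split=> // i; rewrite -CK.
rewrite -(sum_fibers p (fun q j => C i q * wwt j)).
by apply: eq_bigr => q _; rewrite -mulr_sumr mp.1.
Qed.

Lemma sum_push_clustering (C : 'I_k -> W -> R) (F : W' -> R) i :
  \sum_(q : W') push_clustering p C i q * wwt q * F q =
  \sum_(j : W) C i j * wwt j * F (p j).
Proof.
rewrite -(sum_fibers p (fun q j => C i j * wwt j * F q)).
apply: eq_bigr => q _; rewrite -mulr_suml; congr (_ * _).
by rewrite /push_clustering mulrAC mulVf ?mul1r // gt_eqF ?wwt_gt0.
Qed.

Lemma push_clusteringP (C : 'I_k -> W -> R) :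
  clusterings kappa W C -> clusterings kappa W' (push_clustering p C).
Proof.
move=> [C01 C1 CK]; apply: clusteringsI => [i q|q|i].
- apply: mulr_ge0; first by rewrite invr_ge0 ltW ?wwt_gt0.
  apply: sumr_ge0 => j _.
  by rewrite mulr_ge0 ?(ltW (wwt_gt0 _)) //; case/andP: (C01 i j).
- rewrite -mulr_sumr exchange_big /=.
  under eq_bigr do rewrite -mulr_suml C1 mul1r.
  by rewrite mp.1 mulVf // gt_eqF ?wwt_gt0.
- rewrite -(CK i).
  have := sum_push_clustering C (fun=> 1) i.
  by under eq_bigr do rewrite mulr1; under [in RHS]eq_bigr do rewrite mulr1.
Qed.

(** Inside a fiber [F (p j)] is constant and the displacements average out. *)
Lemma merging_orthogonal (F : W' -> R) t :
  \sum_(j : W) wwt j * (wpt j 0 t - wpt (p j) 0 t) * F (p j) = 0.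
Proof.
rewrite -(sum_fibers p (fun q j => wwt j * (wpt j 0 t - wpt q 0 t) * F q)).
by apply: big1 => q _; rewrite -mulr_suml mp.2 mul0r.
Qed.

(** Parallel axis identity: expand
    [wpt j - s i = (wpt j - wpt (p j)) + (wpt (p j) - s i)] in the squared norm.
    The fractions of a point sum to 1, which turns the first squares into the
    spread, and the part of the cross terms free of [s] vanishes by
    [merging_orthogonal]. *)
Lemma clustering_cost_merged (C : 'I_k -> W -> R) (s : 'I_k -> 'rV[R]_d) :
    (forall j, \sum_(i < k) C i j = 1) ->
  \sum_(i < k) \sum_(j : W) C i j * wwt j * sqnorm (wpt (p j) - s i)
    + merging_spread p
  = clustering_cost C s + \sum_(t < d) merging_error p C s t.
Proof.
move=> C1.
have -> : merging_spread p =
    \sum_(i < k) \sum_(j : W) C i j * wwt j * sqnorm (wpt j - wpt (p j)).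
  rewrite exchange_big; apply: eq_bigr => j _.
  by rewrite -!mulr_suml C1 mul1r.
have E0 : \sum_(i < k) \sum_(j : W) \sum_(t < d)
    C i j * wwt j * (wpt j 0 t - wpt (p j) 0 t) * wpt (p j) 0 t = 0.
  rewrite exchange_big /=; under eq_bigr do rewrite exchange_big /=.
  rewrite exchange_big /=; apply: big1 => t _.
  rewrite -[RHS](merging_orthogonal (fun q => wpt q 0 t) t).
  by apply: eq_bigr => j _; rewrite -!mulr_suml C1 mul1r.
have -> : \sum_(t < d) merging_error p C s t =
  \sum_(i < k) \sum_(j : W) \sum_(t < d)
    2 * (C i j * wwt j * (wpt j 0 t - wpt (p j) 0 t) * s i 0 t).
  under [RHS]eq_bigr do rewrite exchange_big /=.
  rewrite [RHS]exchange_big /=; apply: eq_bigr => t _.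
  rewrite /merging_error mulr_sumr; apply: eq_bigr => i _.
  by rewrite mulr_sumr.
move: (congr1 ( *%R (-2)) E0); rewrite mulr0 => E2.
apply: subr0_eq; rewrite -[RHS]E2.
rewrite mulr_sumr /clustering_cost opprD -!sumrN -!big_split /=.
apply: eq_bigr => i _; rewrite mulr_sumr -!sumrN -!big_split /=.
apply: eq_bigr => j _; rewrite /sqnorm !mulr_sumr -!sumrN -!big_split /=.
by apply: eq_bigr => t _; rewrite !mxE; ring.
Qed.

(** The fractions of a pulled-back clustering are constant on fibers, so its cross
    terms vanish. *)
Lemma pull_clustering_cost (C : 'I_k -> W' -> R) (s : 'I_k -> 'rV[R]_d) :
    (forall q, \sum_(i < k) C i q = 1) ->
  clustering_cost (fun i j => C i (p j)) s =
  clustering_cost C s + merging_spread p.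
Proof.
move=> C1; apply/esym; have := @clustering_cost_merged (fun i j => C i (p j)) s.
have -> : \sum_(t < d) merging_error p (fun i j => C i (p j)) s t = 0.
  apply: big1 => t _; rewrite /merging_error big1 ?mulr0 // => i _.
  rewrite -[RHS](merging_orthogonal (fun q => C i q * s i 0 t) t).
  by apply: eq_bigr => j _; ring.
rewrite addr0 => <- //; congr (_ + _); apply: eq_bigr => i _.
rewrite -(sum_fibers p (fun q j => C i q * wwt j * sqnorm (wpt q - s i))).
by apply: eq_bigr => q _; rewrite -mulr_suml -mulr_sumr mp.1.
Qed.

Lemma push_clustering_cost (C : 'I_k -> W -> R) (s : 'I_k -> 'rV[R]_d) :
    (forall j, \sum_(i < k) C i j = 1) ->
  clustering_cost (push_clustering p C) s + merging_spread p =
  clustering_cost C s + \sum_(t < d) merging_error p C s t.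
Proof.
move=> C1; rewrite -clustering_cost_merged //; congr (_ + _).
apply: eq_bigr => i _.
exact: (@sum_push_clustering C (fun q => sqnorm (wpt q - s i))).
Qed.

(** An optimal clustering of [W'] costs at most the push-forward of an optimal
    clustering of [W], so only the cross terms of the latter matter. *)
Lemma merging_coreset (eps : R) :
    0 <= eps -> clusterings kappa W !=set0%classic ->
    (forall s C, clusterings kappa W C ->
       (forall C', clusterings kappa W C' ->
          clustering_cost C s <= clustering_cost C' s) ->
       \sum_(t < d) merging_error p C s t <= eps * clustering_cost C s) ->
  is_coreset eps kappa W W'.
Proof.
move=> eps0 W0 small.
exists (fun C i j => C i (p j)), (merging_spread p).
have cost0 (V : wset R d) C s :
    clusterings kappa V C -> 0 <= clustering_cost C s.
  move=> [C01 _ _]; apply: sumr_ge0 => i _; apply: sumr_ge0 => j _.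
  rewrite mulr_ge0 ?mulr_ge0 ?(ltW (wwt_gt0 _)) //.
    by case/andP: (C01 i j).
  by apply: sumr_ge0 => t _; exact: sqr_ge0.
split=> [C||s C _ CK]; first exact: pull_clustering.
  apply: sumr_ge0 => j _; rewrite mulr_ge0 ?(ltW (wwt_gt0 _)) //.
  by apply: sumr_ge0 => t _; exact: sqr_ge0.
have [_ C1 _] := CK; split.
  rewrite -pull_clustering_cost // ler_piMl ?cost0 //; last by lra.
  exact: pull_clustering.
have [Co CoK [<- Copt]] := min_cost_attained s W0.
have [Cm _ [<- Cmopt]] :=
  @min_cost_attained _ _ _ kappa W' s (ex_intro _ C CK).
have [_ Co1 _] := CoK.
rewrite (le_trans (y := clustering_cost (push_clustering p Co) s
  + merging_spread p)) ?lerD2r ?Cmopt //; first exact: push_clusteringP.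
by rewrite push_clustering_cost // mulrDl mul1r lerD2l small.
Qed.

End Merging.

(** * Optimal clusterings are monotone *)

Lemma sum_indicator (R : pzRingType) (I : finType) (j : I) (F : I -> R) :
  \sum_m (m == j)%:R * F m = F j.
Proof.
rewrite (bigD1 j) //= eqxx mul1r big1 ?addr0 // => m /negbTE ->.
by rewrite mul0r.
Qed.

(** Swap as much mass as possible between the [j]-part of cluster [i] and the
    [h]-part of cluster [l]: cluster sizes are kept, and the cost changes by the
    swapped mass times twice the scalar product below. *)
Lemma exchange_optimal (R : realType) (d k : nat) (kappa : 'I_k -> R)
    (W : wset R d) (s : 'I_k -> 'rV[R]_d) (C : 'I_k -> W -> R)
    (i l : 'I_k) (j h : W) :
    clusterings kappa W C ->
    (forall C', clusterings kappa W C' ->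
       clustering_cost C s <= clustering_cost C' s) ->
    0 < C i j -> 0 < C l h ->
  0 <= \sum_(t < d) (wpt j 0 t - wpt h 0 t) * (s i 0 t - s l 0 t).
Proof.
move=> [C01 C1 CK] Copt Cij Clh.
have [<-|nil] := eqVneq i l.
  by rewrite big1 // => t _; rewrite subrr mulr0.
have [<-|njh] := eqVneq j h.
  by rewrite big1 // => t _; rewrite subrr mul0r.
(* The swap is the rank one perturbation of the masses with margins u and v, both
   of sum 0; dividing by the weight turns masses into fractions. *)
pose u (m : W) : R := (m == j)%:R - (m == h)%:R.
pose v (m : 'I_k) : R := (m == l)%:R - (m == i)%:R.
have sumu (F : W -> R) : \sum_m u m * F m = F j - F h.
  by under eq_bigr do rewrite mulrBl; rewrite sumrB !sum_indicator.
have sumv (F : 'I_k -> R) : \sum_m v m * F m = F l - F i.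
  by under eq_bigr do rewrite mulrBl; rewrite sumrB !sum_indicator.
pose delta := Num.min (C i j * wwt j) (C l h * wwt h).
have delta0 : 0 < delta by rewrite lt_min !mulr_gt0 ?wwt_gt0.
pose C' a b := C a b + delta / wwt b * u b * v a.
have C'K : clusterings kappa W C'.
  apply: clusteringsI => [a b|b|a].
  - rewrite /C' /u /v; have wb := wwt_gt0 b.
    have Cab : 0 <= C a b by case/andP: (C01 a b).
    have q0 : 0 <= delta / wwt b by rewrite divr_ge0 // ltW.
    have [eal|nal] := eqVneq a l; have [eai|nai] := eqVneq a i;
      have [ebj|nbj] := eqVneq b j; have [ebh|nbh] := eqVneq b h;
      rewrite ?subr0 ?sub0r ?subrr ?mulr0 ?mul0r ?mulr1 ?mulrN1 ?mulr1 ?addr0;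
      rewrite ?opprK //;
      rewrite ?(addr_ge0 Cab q0) // subr_ge0 ler_pdivrMr // ge_min.
    + by rewrite eal ebh lexx orbT.
    + by rewrite eai ebj lexx.
  - rewrite big_split /= C1 -mulr_sumr.
    have := sumv (fun=> 1); rewrite subrr; under eq_bigr do rewrite mulr1.
    by move=> ->; rewrite mulr0 addr0.
  - under eq_bigr do rewrite mulrDl; rewrite big_split /= CK.
    rewrite -[RHS]addr0; congr (_ + _).
    have E := sumu (fun=> delta * v a); rewrite subrr in E; rewrite -[RHS]E.
    apply: eq_bigr => b _; have := wwt_gt0 b => wb.
    by field; rewrite gt_eqF.
have := Copt _ C'K.
have -> : clustering_cost C' s = clustering_cost C s +
   delta * \sum_a v a * \sum_b u b * sqnorm (wpt b - s a).
  rewrite mulr_sumr -big_split /=; apply: eq_bigr => a _.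
  rewrite !mulr_sumr -big_split /=; apply: eq_bigr => b _.
  by rewrite /C'; field; rewrite gt_eqF ?wwt_gt0.
rewrite lerDl pmulr_rge0 // sumv !sumu /sqnorm -!sumrB.
set X := \sum_(t < d) _ => X0.
have -> : \sum_(t < d) (wpt j 0 t - wpt h 0 t) * (s i 0 t - s l 0 t) = X / 2.
  rewrite /X mulr_suml; apply: eq_bigr => t _; rewrite !mxE.
  by field.
by rewrite divr_ge0.
Qed.

(** * Blocks of consecutive points on a line *)

(** A line is scaled so that its [N] points are the odd numbers [2 v + 1]. A block
    of [B] consecutive points starting at [2 B q + 1] then has center
    [B (2 q + 1)], and the offset of a point from the center of its block depends
    on the residue of its index only. *)

Definition block_offset (R : realType) (B v : nat) : R :=
  (v %% B)%:R *+ 2 + 1 - B%:R.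

Section Blocks.
Variables (N M B : nat) (b : 'I_N -> 'I_M).
Hypotheses (NE : N = (M * B)%N) (bE : forall v, b v = (v %/ B)%N :> nat).

Lemma big_block (V : nmodType) (F : nat -> V) (q : 'I_M) :
  \sum_(v | b v == q) F (v %% B)%N = \sum_(r < B) F r.
Proof.
have [B0|B0] := posnP B.
  move: NE (b) (F); rewrite B0 muln0 => -> b' F'.
  by rewrite !big_ord0.
have hP (r : 'I_B) : (q * B + r < N)%N.
  by rewrite NE; have := ltn_ord q; have := ltn_ord r; nia.
rewrite (reindex_onto (fun r => Ordinal (hP r))
  (fun v : 'I_N => Ordinal (ltn_pmod v B0))) /= => [|v /eqP/(congr1 val)/=].
  rewrite (eq_bigl xpredT) => [|r].
    by apply: eq_bigr => r _; rewrite modnMDl modn_small.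
  by rewrite -!val_eqE /= bE /= modnMDl divnMDl // divn_small // modn_small //
    addn0 !eqxx.
by rewrite bE => vq; apply/val_inj; rewrite /= -vq -divn_eq.
Qed.

Variable R : realType.
Local Notation off := (block_offset R B).

Lemma sum_block_offset (q : 'I_M) : \sum_(v | b v == q) off v = 0.
Proof.
rewrite (big_block (fun r => r%:R *+ 2 + 1 - B%:R : R)).
have E (x : R) n : \sum_(r < n) (r%:R *+ 2 + 1 - x) = n%:R * (n%:R - x).
  elim: n => [|n IH]; first by rewrite big_ord0 mul0r.
  by rewrite big_ord_recr /= IH -[in RHS]natr1; ring.
by rewrite E subrr mulr0.
Qed.

Lemma sum_block_offset_sqr (q : 'I_M) :
  \sum_(v | b v == q) off v ^+ 2 <= B%:R ^+ 3 / 3.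
Proof.
rewrite (big_block (fun r => (r%:R *+ 2 + 1 - B%:R) ^+ 2 : R)).
have E (x : R) n : \sum_(r < n) (r%:R *+ 2 + 1 - x) ^+ 2 =
    n%:R * (4 * n%:R ^+ 2 - 1) / 3 - 2 * x * n%:R ^+ 2 + n%:R * x ^+ 2.
  elim: n => [|n IH].
    by rewrite big_ord0 expr0n /= !mul0r !mulr0 subr0 addr0.
  by rewrite big_ord_recr /= IH -[in RHS]natr1; field.
rewrite E; have : 0 <= B%:R :> R by [].
by move=> ?; lra.
Qed.

Lemma block_center (v : 'I_N) :
  v%:R *+ 2 + 1 - off v = B%:R * ((b v)%:R *+ 2 + 1) :> R.
Proof. by rewrite bE /block_offset {1}(divn_eq v B) natrD natrM; ring. Qed.

Lemma block_le (v w : 'I_N) : (b v < b w)%N -> (v < w)%N.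
Proof.
by rewrite !bE !(ltnNge _ (_ : nat)); apply: contra; exact: leq_div2r.
Qed.

End Blocks.

(** * Monotone clusterings of a line *)

Section Line.
Variables (R : realType) (k N : nat) (xi : 'I_k -> 'I_N -> R) (a : 'I_k -> R).
Hypotheses (xi0 : forall i v, 0 <= xi i v)
  (xi1 : forall v, \sum_(i < k) xi i v = 1).

Local Notation y v := (v%:R *+ 2 + 1 : R).

(** At scale [r = N / (2 k)], the points at distance less than [r] from a given
    site lie within an interval of length [2 r] and have mutual distance 2, so
    there are at most [r + 1] of them. Hence at most [N / 2 + k <= 3/5 N] points
    are close to some site, and each of the others costs at least [r^2]. *)
Lemma quantization_bound : (0 < k)%N -> (10 * k <= N)%N ->
  N%:R ^+ 3 / (10 * k%:R ^+ 2) <=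
  \sum_(i < k) \sum_(v < N) xi i v * (y v - a i) ^+ 2.
Proof.
move=> k0 kN.
have k0R : 0 < k%:R :> R by rewrite ltr0n.
have kNR : 10 * k%:R <= N%:R :> R by rewrite -natrM ler_nat.
pose r : R := N%:R / (2 * k%:R).
have r0 : 0 <= r by rewrite divr_ge0 // mulr_ge0 ?ltW.
pose near i : {set 'I_N} := [set v : 'I_N | `|y v - a i| < r].
pose U := (\bigcup_(i < k) near i)%SET.
have cardn i : #|near i|%:R <= r + 1.
  have [->|[v0 v0i]] := set_0Vmem (near i); first by rewrite cards0; lra.
  have [v vi vmin] := @arg_minnP _ v0 (mem (near i)) val v0i.
  have Tr := truncn_itv r0.
  set T := Num.truncn r in Tr *.
  have sub w : w \in near i -> (w - v < T.+1)%N.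
    move=> wi; rewrite -(ltr_nat R) natrB ?vmin //.
    apply: le_lt_trans (_ : r < _); last by case/andP: Tr.
    move: wi vi; rewrite !inE !ltr_norml => /andP[_ ?] /andP[? _]; lra.
  have : (#|near i| <= #|'I_T.+1|)%N.
    pose f (w : 'I_N) : 'I_T.+1 := inord (w - v).
    apply: (@leq_card_in _ _ f (mem (near i))) => w w' wi w'i /(congr1 val).
    rewrite /= !inordK ?sub // => e; apply/val_inj => /=.
    by have := vmin _ wi; have := vmin _ w'i => /=; lia.
  rewrite card_ord -(ler_nat R) => /le_trans; apply.
  by rewrite -natr1 lerD2r; case/andP: Tr.
have cardU : #|U|%:R <= N%:R / 2 + k%:R :> R.
  have : (#|U| <= \sum_(i < k) #|near i|)%N.
    rewrite /U; elim/big_rec2 : _ => [|i n A _ le]; first by rewrite cards0.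
    by rewrite (leq_trans (leq_card_setU _ _)) // leq_add2l.
  rewrite -(ler_nat R) natr_sum => /le_trans; apply.
  apply: le_trans (ler_sum _ (fun i _ => cardn i)) _.
  rewrite sumr_const card_ord -mulr_natl /r le_eqVlt; apply/orP; left.
  by apply/eqP; field; rewrite gt_eqF.
rewrite exchange_big /= (bigID (mem U)) /= -[X in X <= _]add0r.
apply: lerD.
  apply: sumr_ge0 => v _; apply: sumr_ge0 => i _.
  by rewrite mulr_ge0 // sqr_ge0.
apply: le_trans (_ : \sum_(v | v \notin U) r ^+ 2 <= _); last first.
  apply: ler_sum => v vU.
  have -> : r ^+ 2 = \sum_(i < k) xi i v * r ^+ 2.
    by rewrite -mulr_suml xi1 mul1r.
  apply: ler_sum => i _.
  rewrite ler_wpM2l // -[X in _ <= X]real_normK ?num_real //.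
  rewrite lerXn2r ?nnegrE //.  rewrite leNgt; apply: contra vU => ?.
  by apply/finset.bigcupP; exists i => //; rewrite inE.
rewrite sumr_const -cardsE.
have -> : [set v | v \notin U]%SET = (~: U)%SET.
  by apply/setP => v; rewrite !inE.
have cU : (#|~: U|)%:R = N%:R - #|U|%:R :> R.
  have := cardsC U; rewrite card_ord => /(congr1 (GRing.natmul (1 : R))).
  by rewrite natrD => <-; ring.
rewrite -[X in _ <= X]mulr_natl cU.
have -> : N%:R ^+ 3 / (10 * k%:R ^+ 2) = 2 / 5 * N%:R * r ^+ 2.
  by rewrite /r; field; rewrite gt_eqF.
rewrite ler_wpM2r ?sqr_ge0 //; lra.
Qed.

Hypothesis mono : forall i l (v w : 'I_N), 0 < xi i v -> 0 < xi l w ->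
  (v < w)%N -> a i <= a l.

Section LineBlocks.
Variables (M B : nat) (b : 'I_N -> 'I_M).
Hypotheses (NE : N = (M * B)%N) (bE : forall v, b v = (v %/ B)%N :> nat).
Local Notation off := (block_offset R B).

(** The witness [i] must not be the rightmost site used in block [q]; this makes
    the choice of a witness injective in [q]. *)
Definition splits (q : 'I_M) (i : 'I_k) :=
  [exists v, exists w, exists l,
    [&& b v == q, b w == q, 0 < xi i v, 0 < xi l w & a i < a l]].

Definition split_block (q : 'I_M) := [exists i, splits q i].

(** Choosing for each split block a site that is not the rightmost one there is
    injective: by monotonicity, a site used in a later block is at least as far
    right as every site of an earlier block. *)
Lemma card_split_block : (#|split_block| <= k)%N.
Proof.
have [i0 _|k0] := pickP (fun _ : 'I_k => true); last first.
  by rewrite eq_card0 // => q; apply/negbTE/existsPn => i; have := k0 i.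
pose f q := odflt i0 [pick i | splits q i].
have fP q : q \in split_block -> splits q (f q).
  move=> /existsP[i qi]; rewrite /f; case: pickP => // /(_ i).
  by rewrite qi.
rewrite -[X in (_ <= X)%N]card_ord.
have no_lt (q q' : 'I_M) : (q < q')%N -> f q = f q' -> q \in split_block ->
    q' \in split_block -> False.
  move=> qq' e /fP + /fP; rewrite -e.
  case/existsP => v /existsP[w /existsP[l /and5P[_ /eqP wq _ lw fl]]].
  case/existsP => v' /existsP[w' /existsP[l' /and5P[/eqP v'q _ fv' _ _]]].
  suff : a l <= a (f q) by rewrite leNgt fl.
  by apply: mono lw fv' _; rewrite (block_le bE) // wq v'q.
apply: (@leq_card_in _ _ f split_block) => q q' qs q's e.
case: (ltngtP q q') => [/no_lt|/no_lt|/val_inj//].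
  by move/(_ e qs q's).
by move/(_ (esym e) q's qs).
Qed.

(** In a block that is not split all sites in use coincide, and the offsets sum to
    zero. *)
Lemma intact_block_error (q : 'I_M) : q \notin split_block ->
  \sum_(v | b v == q) \sum_(i < k) xi i v * off v * a i = 0.
Proof.
move=> nq.
have [v0 v0q|none] := pickP (fun v => b v == q); last by rewrite big_pred0.
have [i0 xi0v0] : exists i, 0 < xi i v0.
  apply/existsP; apply: contraT => /existsPn h.
  have := xi1 v0; rewrite big1 => [/eqP|i _]; first by rewrite eq_sym oner_eq0.
  by apply/eqP; rewrite eq_le xi0 andbT leNgt h.
have same v i : b v == q -> 0 < xi i v -> a i = a i0.
  move=> vq xiv; apply/eqP; rewrite eq_le !leNgt; apply/andP; split.
    apply: contra nq => h; apply/existsP; exists i0.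
    by apply/existsP; exists v0; apply/existsP; exists v; apply/existsP;
      exists i; rewrite v0q vq xi0v0 xiv h.
  apply: contra nq => h; apply/existsP; exists i.
  by apply/existsP; exists v; apply/existsP; exists v0; apply/existsP;
    exists i0; rewrite v0q vq xi0v0 xiv h.
have E := congr1 ( *%R^~ (a i0)) (sum_block_offset NE bE R q).
rewrite /= mul0r in E; rewrite -[RHS]E mulr_suml; apply: eq_bigr => v vq.
have -> : off v * a i0 = \sum_(i < k) xi i v * off v * a i0.
  by rewrite -!mulr_suml xi1 mul1r.
apply: eq_bigr => i _; have [->|xin0] := eqVneq (xi i v) 0.
  by rewrite !mul0r.
by rewrite (same v i) // lt_def xin0 xi0.
Qed.

(** Write [y = c + off] with [c] the center of the block. As the offsets sum to
    zero, [2 off a] may be replaced by [2 off (a - c) = 2 off (a - y) + 2 off^2],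
    where [2 off (a - y) <= lam (y - a)^2 + off^2 / lam]. *)
Lemma block_error (lam : R) (q : 'I_M) : 0 < lam ->
  2 * (\sum_(v | b v == q) \sum_(i < k) xi i v * off v * a i) <=
  lam * (\sum_(v | b v == q) \sum_(i < k) xi i v * (y v - a i) ^+ 2) +
  (lam^-1 + 2) * (B%:R ^+ 3 / 3).
Proof.
move=> lam0.
pose c : R := B%:R * (q%:R *+ 2 + 1).
apply: le_trans (_ : _ <=
    lam * (\sum_(v | b v == q) \sum_(i < k) xi i v * (y v - a i) ^+ 2) +
    (lam^-1 + 2) * (\sum_(v | b v == q) off v ^+ 2)) _; last first.
  rewrite lerD2l ler_wpM2l ?(sum_block_offset_sqr NE bE) //.
  by rewrite addr_ge0 ?invr_ge0 ?ltW.
have E := congr1 ( *%R (2 * c)) (sum_block_offset NE bE R q).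
rewrite mulr0 in E; rewrite -[X in _ <= X]addr0 -[X in _ <= _ + X]E.
rewrite !mulr_sumr -!big_split /=; apply: ler_sum => v /eqP vq.
have yE : y v = c + off v by rewrite /c -vq -(block_center bE); ring.
have mulxi (x : R) : x = \sum_(i < k) xi i v * x.
  by rewrite -mulr_suml xi1 mul1r.
rewrite [(_ + 2) * _]mulxi [2 * c * _]mulxi !mulr_sumr -!big_split /=.
apply: ler_sum => i _; rewrite yE -subr_ge0.
set o := off v.
have -> : lam * (xi i v * (c + o - a i) ^+ 2) + xi i v * ((lam^-1 + 2) * o ^+ 2)
    + xi i v * (2 * c * o) - 2 * (xi i v * o * a i) =
    xi i v * lam * (c + o - a i + lam^-1 * o) ^+ 2.
  by field; rewrite gt_eqF.
by apply: mulr_ge0 (sqr_ge0 _); rewrite mulr_ge0 // ltW.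
Qed.

(** [block_error] with [lam = eps / 2], summed over the at most [k] split blocks:
    the sum of the squared offsets is at most [k B^3 / 3] with [B = N / M], and
    [quantization_bound] bounds [N^3] by [10 k^2] times the cost. *)
Lemma line_error (eps : R) :
    (0 < k)%N -> (10 * k <= N)%N -> 0 < eps -> eps <= 1 / 2 ->
    32 * k%:R ^+ 3 <= M%:R ^+ 3 * eps ^+ 2 ->
  2 * (\sum_(i < k) \sum_(v < N) xi i v * off v * a i) <=
  eps * (\sum_(i < k) \sum_(v < N) xi i v * (y v - a i) ^+ 2).
Proof.
move=> k0 kN eps0 eps12 Meps.
have k0R : 0 < k%:R :> R by rewrite ltr0n.
have Qge := quantization_bound k0 kN.
set Q := (X in eps * X); set E := (X in 2 * X).
have lam0 : 0 < eps / 2 by rewrite divr_gt0.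
have EQ : 2 * E <= eps / 2 * Q + k%:R * (((eps / 2)^-1 + 2) * (B%:R ^+ 3 / 3)).
  rewrite /E /Q exchange_big [X in _ <= _ * X + _]exchange_big /=.
  rewrite (partition_big b xpredT) //=.
  rewrite [X in _ <= _ * X + _](partition_big b xpredT) //= !mulr_sumr.
  rewrite (bigID split_block) /= [X in _ + X]big1 ?addr0; last first.
    by move=> q nq; rewrite intact_block_error ?mulr0.
  apply: le_trans (ler_sum _ (fun q _ => block_error q lam0)) _.
  rewrite big_split /=; apply: lerD.
    rewrite [X in _ <= X](bigID split_block) /= lerDl.
    apply: sumr_ge0 => q _; apply: (mulr_ge0 (ltW lam0)).
    apply: sumr_ge0 => v _; apply: sumr_ge0 => i _.
    by rewrite mulr_ge0 ?sqr_ge0.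
  rewrite sumr_const -[X in X <= _]mulr_natl.
  rewrite ler_wpM2r ?ler_nat ?card_split_block //.
  apply: mulr_ge0; last by rewrite divr_ge0.
  by rewrite addr_ge0 // invr_ge0 ltW.
apply: le_trans EQ _.
have kB : k%:R * B%:R ^+ 3 <= 10 / 32 * eps ^+ 2 * Q.
  apply: le_trans (_ : _ <=
      10 / 32 * eps ^+ 2 * (N%:R ^+ 3 / (10 * k%:R ^+ 2))) _.
    rewrite NE natrM -subr_ge0.
    have -> : 10 / 32 * eps ^+ 2 * ((M%:R * B%:R) ^+ 3 / (10 * k%:R ^+ 2)) -
       k%:R * B%:R ^+ 3 = B%:R ^+ 3 / (32 * k%:R ^+ 2) *
       (M%:R ^+ 3 * eps ^+ 2 - 32 * k%:R ^+ 3).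
      by field; rewrite gt_eqF.
    by apply: mulr_ge0; rewrite ?subr_ge0 // divr_ge0 ?exprn_ge0 // mulr_ge0.
  by rewrite ler_wpM2l // mulr_ge0 ?sqr_ge0.
have Q0 : 0 <= Q by apply: le_trans Qge; rewrite divr_ge0 ?mulr_ge0 ?exprn_ge0.
have -> : k%:R * (((eps / 2)^-1 + 2) * (B%:R ^+ 3 / 3)) =
    (k%:R * B%:R ^+ 3) * (2 / eps + 2) / 3.
  by field; rewrite gt_eqF.
have F0 : 0 <= (2 / eps + 2) / 3.
  by rewrite divr_ge0 // addr_ge0 // divr_ge0 // ltW.
have := ler_wpM2r F0 kB; rewrite mulrA => h.
apply: le_trans (_ : _ <=
    eps / 2 * Q + 10 / 32 * eps ^+ 2 * Q * ((2 / eps + 2) / 3)) _.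
  by rewrite lerD2l.
have -> : 10 / 32 * eps ^+ 2 * Q * ((2 / eps + 2) / 3) =
   10 / 32 * (eps * 2 + 2 * eps * eps) / 3 * Q.
  by field; rewrite gt_eqF.
rewrite -mulrDl ler_wpM2r //.
have : eps * eps <= eps * (1 / 2) by rewrite ler_pM2l.
lra.
Qed.
End LineBlocks.
End Line.

(** * Coarsening resolution sets *)

(** The line through [j] in direction [t], parametrized by its [t]-th index. *)
Definition line_point (d : nat) (rho : 'I_d -> nat) (t : 'I_d)
    (j : grid_index rho) (v : 'I_(2 ^ rho t)) : grid_index rho :=
  finfun (eqtype.dfwith j v).
Arguments line_point {d rho} t j v.

Lemma line_point_in d (rho : 'I_d -> nat) t (j : grid_index rho) v :
  line_point t j v t = v.
Proof. by rewrite ffunE dfwith_in. Qed.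

Lemma line_point_out d (rho : 'I_d -> nat) t u (j : grid_index rho) v :
  t != u -> line_point t j v u = j u.
Proof. by move=> tu; rewrite ffunE dfwith_out. Qed.

(** The line through each [j] is visited, so every line is counted as often as it
    has points. *)
Lemma sum_lines (V : nmodType) d (rho : 'I_d -> nat) t
    (F : grid_index rho -> V) :
  \sum_j \sum_(v < 2 ^ rho t) F (line_point t j v) = (\sum_j F j) *+ 2 ^ rho t.
Proof.
(* Exchanging the running coordinate with the coordinate of the base point turns
   the summand [F (line_point t j v)] into [F j]. *)
pose swap (x : grid_index rho * 'I_(2 ^ rho t)) :=
  (line_point t x.1 x.2, x.1 t).
have swapK : involutive swap.
  case=> j v; rewrite /swap /= line_point_in; congr pair.
  apply/ffunP => u; rewrite !ffunE; case: eqtype.dfwithP => // u' tu.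
  by rewrite line_point_out.
have -> : (\sum_j F j) *+ 2 ^ rho t = \sum_j \sum_(v < 2 ^ rho t) F j.
  rewrite -sumrMnl; apply: eq_bigr => j _.
  by rewrite sumr_const card_ord.
rewrite !pair_bigA [RHS](reindex swap) //=.
by exists swap => ? _; exact: swapK.
Qed.

Lemma grid_coord (R : realType) d (rho : 'I_d -> nat) (j : grid_index rho) t :
  grid_point R j 0 t = ((j t)%:R *+ 2 + 1) / (2 * (2 ^ rho t)%:R).
Proof. by rewrite mxE exprS natrX; field; rewrite expf_neq0. Qed.

Lemma coarse_index_subproof m n (v : 'I_(2 ^ n)) : (m <= n)%N ->
  (v %/ 2 ^ (n - m) < 2 ^ m)%N.
Proof. by move=> mn; rewrite ltn_divLR ?expn_gt0 // -expnD subnKC. Qed.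

Definition coarse_index m n (mn : (m <= n)%N) (v : 'I_(2 ^ n)) : 'I_(2 ^ m) :=
  Ordinal (coarse_index_subproof v mn).

Section Coarsening.
Variables (R : realType) (d : nat) (rho tau : 'I_d -> nat).
Hypothesis tau_le : forall t, (tau t <= rho t)%N.

Definition coarsening (j : resolution_set R rho) : resolution_set R tau :=
  [ffun t => coarse_index (tau_le t) (j t)] : grid_index tau.

Lemma pow_split t : (2 ^ rho t = 2 ^ tau t * 2 ^ (rho t - tau t))%N.
Proof. by rewrite -expnD subnKC. Qed.

Lemma coarse_indexE t (v : 'I_(2 ^ rho t)) :
  coarse_index (tau_le t) v = (v %/ 2 ^ (rho t - tau t))%N :> nat.
Proof. by []. Qed.

Lemma coarsening_offset (j : resolution_set R rho) t :
  wpt j 0 t - wpt (coarsening j) 0 t =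
  block_offset R (2 ^ (rho t - tau t)) ((j : grid_index rho) t)
    / (2 * (2 ^ rho t)%:R).
Proof.
rewrite /= !grid_coord /coarsening ffunE.
have := block_center (@coarse_indexE t) R ((j : grid_index rho) t).
set o := block_offset _ _ _ => /(canRL (subrK _)) ->.
have -> : (2 ^ rho t)%:R = (2 ^ tau t)%:R * (2 ^ (rho t - tau t))%:R :> R.
  by rewrite -natrM -pow_split.
by field; rewrite !pnatr_eq0 -!lt0n !expn_gt0.
Qed.

Lemma coarsening_merging : merging coarsening.
Proof.
split=> [q|q t].
  rewrite /= sumr_const.
  have -> : #|[pred j | coarsening j == q]| =
      (\prod_(t < d) 2 ^ (rho t - tau t))%N.
    pose F t : pred 'I_(2 ^ rho t) :=
      [pred v | coarse_index (tau_le t) v == (q : grid_index tau) t].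
    transitivity #|(family F : simpl_pred (grid_index rho))|.
      apply: eq_card => j; rewrite !inE; apply/eqP/familyP => [e t|h].
        by rewrite inE -e /coarsening ffunE.
      by apply/ffunP => t; rewrite /coarsening ffunE; apply/eqP; exact: h.
    rewrite card_family foldrE big_map big_enum /=; apply: eq_bigr => t _.
    rewrite -sum1_card (big_block (pow_split t) (@coarse_indexE t) (fun=> 1%N)).
    by rewrite sum1_card card_ord.
  rewrite /resolution_weight -[LHS]mulr_natr natr_prod -big_split /=.
  apply: eq_bigr => t _; rewrite -{1}(subnKC (tau_le t)) natrX exprD; field.
  by rewrite !expf_neq0.
apply: (mulIf (_ : (2 ^ rho t)%:R != 0 :> R)).
  by rewrite pnatr_eq0 -lt0n expn_gt0.
rewrite mul0r mulr_natr big_mkcond -(sum_lines t) /=.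
apply: big1 => j _; rewrite -big_mkcond /=.
have [same|diff] := boolP [forall u, (u != t) ==>
    (coarse_index (tau_le u) ((j : grid_index rho) u)
     == (q : grid_index tau) u)]; last first.
  rewrite big_pred0 // => v; apply: contraNF diff => /eqP e.
  apply/forallP => u; apply/implyP => ut.
  by rewrite -e /coarsening ffunE line_point_out // eq_sym.
have off0 := sum_block_offset (pow_split t) (@coarse_indexE t) R
  ((q : grid_index tau) t).
have E := congr1 ( *%R (resolution_weight R rho / (2 * (2 ^ rho t)%:R))) off0.
rewrite mulr0 in E; rewrite -[RHS]E mulr_sumr; apply: eq_big => v.
  apply/eqP/eqP => [<-|e]; first by rewrite /coarsening ffunE line_point_in.
  apply/ffunP => u; rewrite /coarsening ffunE.
  have [->|ut] := eqVneq u t; first by rewrite line_point_in.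
  rewrite line_point_out 1?eq_sym //.
  by move/forallP: same => /(_ u); rewrite ut => /eqP.
move=> /eqP e; have := coarsening_offset (line_point t j v) t.
by rewrite e /= line_point_in => ->; ring.
Qed.

End Coarsening.

Lemma resolution_cost (R : realType) d k (rho : 'I_d -> nat)
    (C : 'I_k -> resolution_set R rho -> R) s :
  clustering_cost C s =
  \sum_(t < d) \sum_(i < k) \sum_(j : resolution_set R rho)
    C i j * wwt j * (wpt j 0 t - s i 0 t) ^+ 2.
Proof.
rewrite [RHS]exchange_big /=; apply: eq_bigr => i _.
rewrite [RHS]exchange_big /=; apply: eq_bigr => j _.
by rewrite mulr_sumr; apply: eq_bigr => t _; rewrite !mxE.
Qed.

(** [line_error] on each line in direction [t], whose monotonicity hypothesis is
    [exchange_optimal] for two points that differ in coordinate [t] only. *)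
Lemma coordinate_error (R : realType) (d k : nat) (rho tau : 'I_d -> nat)
    (tau_le : forall t, (tau t <= rho t)%N) (kappa : 'I_k -> R) (eps : R)
    (s : 'I_k -> 'rV[R]_d) (C : 'I_k -> resolution_set R rho -> R) (t : 'I_d) :
    clusterings kappa (resolution_set R rho) C ->
    (forall C', clusterings kappa (resolution_set R rho) C' ->
       clustering_cost C s <= clustering_cost C' s) ->
    0 < eps -> eps <= 1 / 2 ->
    (0 < k)%N -> (10 * k <= 2 ^ rho t)%N ->
    32 * k%:R ^+ 3 <= (2 ^ tau t)%:R ^+ 3 * eps ^+ 2 ->
  merging_error (coarsening (R := R) tau_le) C s t <=
  eps * \sum_(i < k) \sum_(j : resolution_set R rho)
    C i j * wwt j * (wpt j 0 t - s i 0 t) ^+ 2.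
Proof.
move=> CK Copt eps0 eps12 k0 kN Meps.
have [C01 C1 _] := CK.
set N := (2 ^ rho t)%N in kN *.
have N0 : 0 < N%:R :> R by rewrite ltr0n expn_gt0.
have nu0 := resolution_weight_gt0 R rho.
set nu := resolution_weight R rho in nu0.
rewrite -(ler_pM2r N0) /merging_error -!mulrA ![_ * N%:R]mulr_natr.
rewrite ![\sum_(i < k) _]exchange_big /= -!(sum_lines t) !mulr_sumr.
apply: ler_sum => j _.
pose xi i (v : 'I_N) := C i (line_point t j v).
(* Scaling by [2 N] sends the coordinates of the line to odd integers. *)
pose a i := 2 * N%:R * s i 0 t.
have mono i l (v w : 'I_N) : 0 < xi i v -> 0 < xi l w ->
    (v < w)%N -> a i <= a l.
  move=> xiv xlw vw; have := exchange_optimal CK Copt xiv xlw.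
  rewrite (bigD1 t) //= big1 ?addr0 => [|u ut]; last first.
    by rewrite !grid_coord !line_point_out 1?eq_sym // subrr mul0r.
  rewrite !grid_coord !line_point_in -/N => h.
  rewrite /a ler_pM2l ?mulr_gt0 // leNgt; apply/negP => lt_s.
  move: h; rewrite leNgt => /negP; apply; rewrite pmulr_llt0 ?subr_gt0 //.
  rewrite -mulrBl pmulr_llt0 ?invr_gt0 ?mulr_gt0 // subr_lt0.
  by rewrite ltrD2r ltr_pMn2r // ltr_nat.
have xi0 i v : 0 <= xi i v by case/andP: (C01 i (line_point t j v)).
have xi1 v : \sum_(i < k) xi i v = 1 by exact: C1.
have := line_error xi0 xi1 mono (pow_split tau_le t)
  (@coarse_indexE _ _ _ tau_le t) k0 kN eps0 eps12 Meps.
pose c : R := nu / (2 * N%:R) ^+ 2.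
have c0 : 0 <= c by rewrite divr_ge0 ?sqr_ge0 // ltW.
move/(ler_wpM2r c0); congr (_ <= _).
  rewrite -mulrA [X in _ = _ * X]exchange_big /= mulr_suml; congr (_ * _).
  apply: eq_bigr => i _; rewrite mulr_suml; apply: eq_bigr => v _.
  have := coarsening_offset tau_le (line_point t j v) t.
  rewrite /= line_point_in => ->; rewrite /xi /a /c -/nu -/N.
  by field; rewrite gt_eqF.
rewrite -mulrA [X in _ = _ * X]exchange_big /= mulr_suml; congr (_ * _).
apply: eq_bigr => i _; rewrite mulr_suml; apply: eq_bigr => v _.
rewrite grid_coord line_point_in /xi /a /c -/nu -/N.
by field; rewrite gt_eqF.
Qed.

Lemma coordinate_error0 (R : realType) (d k : nat) (rho tau : 'I_d -> nat)
    (tau_le : forall t, (tau t <= rho t)%N)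
    (s : 'I_k -> 'rV[R]_d) (C : 'I_k -> resolution_set R rho -> R) (t : 'I_d) :
  tau t = rho t -> merging_error (coarsening (R := R) tau_le) C s t = 0.
Proof.
move=> tt; rewrite /merging_error big1 ?mulr0 // => i _; apply: big1 => j _.
rewrite coarsening_offset tt subnn /block_offset modn1.
by rewrite mul0rn add0r subrr mul0r mulr0 mul0r.
Qed.

(** Every point is shared in the proportions prescribed by [kappa]. *)
Lemma clusterings_neq0 (R : realType) (d k : nat) (rho : 'I_d -> nat)
    (kappa : 'I_k -> R) : (forall i, 0 <= kappa i) ->
  \sum_(i < k) kappa i = 1 ->
  clusterings kappa (resolution_set R rho) !=set0%classic.
Proof.
move=> kappa0 sum1; exists (fun i _ => kappa i).
apply: clusteringsI => // i; rewrite -mulr_sumr /= sumr_const.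
rewrite card_dep_ffun foldrE big_map big_enum /=.
rewrite -[X in _ * X]mulr_natr natr_prod -big_split /= big1 ?mulr1 // => t _.
by rewrite card_ord natrX mulVf // expf_neq0.
Qed.

(** * The choice of the resolution *)

Lemma dyadic_level (R : realType) (x : R) : 2 <= x ->
  exists2 m : nat, (0 < m)%N & 2 ^+ m <= x < 2 ^+ m.+1.
Proof.
move=> x2.
have x0 : 0 <= x by lra.
have := truncn_itv x0; set n := Num.truncn x => /andP[nx xn].
have n2 : (2 <= n)%N by rewrite -ltnS -(ltr_nat R) (le_lt_trans x2).
have /andP[ln ltn] := @trunc_log_bounds 2 n isT (ltnW n2).
exists (trunc_log 2 n); first by rewrite trunc_log_gt0.
apply/andP; split; first by rewrite (le_trans _ nx) // -natrX ler_nat.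
by rewrite (lt_le_trans xn) // -natrX ler_nat.
Qed.

Section Bound.
Variables (R : realType) (k : nat) (eps : R).
Hypotheses (k1 : (1 < k)%N) (eps0 : 0 < eps) (eps12 : eps <= 1 / 2).

(** The number of points allowed per coordinate: its [d]-th power bounds the size
    of the coreset. *)
Definition resolution_bound : R := 2 `^ (8 / 3) * (k%:R / eps `^ (2 / 3)).

Lemma resolution_bound_cube :
  resolution_bound ^+ 3 = 256 * k%:R ^+ 3 / eps ^+ 2.
Proof.
have cube (x y z : R) : 0 <= x -> y * 3 = z -> (x `^ y) ^+ 3 = x `^ z.
  by move=> x0 <-; rewrite -powR_mulrn ?powR_ge0 // -powRrM.
rewrite !exprMn exprVn (cube _ _ 8%:R) //; last by field.
rewrite (cube _ _ 2%:R) ?ltW //; last by field.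
by rewrite !powR_mulrn ?ltW // mulrA; congr (_ * _ / _); ring.
Qed.

Lemma resolution_bound_ge2 : 2 <= resolution_bound.
Proof.
have A0 : 0 <= resolution_bound by rewrite mulr_ge0 ?divr_ge0 ?powR_ge0.
rewrite -(@ler_pXn2r _ 3) ?nnegrE // resolution_bound_cube.
have k3 : 1 <= k%:R ^+ 3 :> R by rewrite exprn_ege1 // ler1n ltnW.
have e1 : eps <= 1 by apply: le_trans eps12 _; lra.
have e2 : eps ^+ 2 <= 1 by rewrite exprn_ile1 // ltW.
rewrite ler_pdivlMr ?exprn_gt0 //; lra.
Qed.

Lemma resolution_bound_level m : resolution_bound < 2 ^+ m.+1 ->
  32 * k%:R ^+ 3 <= (2 ^ m)%:R ^+ 3 * eps ^+ 2.
Proof.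
move=> Am.
have : resolution_bound ^+ 3 <= (2 ^+ m.+1) ^+ 3.
  rewrite lerXn2r ?nnegrE ?exprn_ge0 ?(ltW Am) //.
  by rewrite mulr_ge0 ?divr_ge0 ?powR_ge0.
rewrite resolution_bound_cube ler_pdivrMr ?exprn_gt0 //.
rewrite (exprS 2 m) exprMn natrX.
have -> : 2 ^+ 3 = 8 :> R by ring.
rewrite -mulrA; lra.
Qed.

(** This, and the factor 2 gained when the given resolution exceeds [m], provides
    the [10 k] points needed by [quantization_bound]. *)
Lemma level_large m : 32 * k%:R ^+ 3 <= (2 ^ m)%:R ^+ 3 * eps ^+ 2 ->
  (5 * k <= 2 ^ m)%N.
Proof.
move=> h; rewrite leqNgt; apply/negP => lt.
have : (2 ^ m)%:R ^+ 3 * eps ^+ 2 <= (5 * k)%:R ^+ 3 * (1 / 2) ^+ 2.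
  apply: ler_pM; rewrite ?exprn_ge0 ?(ltW eps0) //.
    by rewrite lerXn2r ?nnegrE // ler_nat ltnW.
  by rewrite lerXn2r ?nnegrE // ltW.
have k3 : 1 <= k%:R ^+ 3 :> R by rewrite exprn_ege1 // ler1n ltnW.
rewrite natrM exprMn; lra.
Qed.
End Bound.

Unset Implicit Arguments.

Theorem theorem1 (R : realType) (d k : nat) (rho : 'I_d -> nat)
    (kappa : 'I_k -> R) (eps : R)
    (hd : (0 < d)%N) (hk : (1 < k)%N) (hrho : forall t, (0 < rho t)%N)
    (hkappa : forall i, exists2 m : nat,
       (0 < m)%N & kappa i = m%:R * resolution_weight R rho)
    (hsum : \sum_(i < k) kappa i = 1)
    (heps0 : 0 < eps) (heps1 : eps <= 1 / 2) :
  exists W' : wset R d,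
    is_resolution_coreset eps kappa rho W' /\
    #|W'|%:R <= 2 `^ (8 / 3 * d%:R) * (k%:R / eps `^ (2 / 3)) ^+ d.
Proof.
have [m m0 /andP[mA Am]] := dyadic_level (resolution_bound_ge2 hk heps0 heps1).
have level := resolution_bound_level heps0 Am.
(* Capping at [rho] leaves a coordinate that is already coarse as it is. *)
pose tau t := minn m (rho t).
have tau_le t : (tau t <= rho t)%N by exact: geq_minr.
exists (resolution_set R tau); split; first split.
- apply: (merging_coreset (coarsening_merging R tau_le)) => [||s C CK Copt].
  + exact: ltW.
  + apply: clusterings_neq0 => // i; have [n _ ->] := hkappa i.
    by rewrite mulr_ge0 // ltW // resolution_weight_gt0.
  rewrite resolution_cost mulr_sumr; apply: ler_sum => t _.
  have [rm|mr] := leqP (rho t) m.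
    rewrite coordinate_error0; last exact/minn_idPr.
    apply: (mulr_ge0 (ltW heps0)).
    apply: sumr_ge0 => i _; apply: sumr_ge0 => j _.
    have [C01 _ _] := CK; have /andP[C0 _] := C01 i j.
    by apply: mulr_ge0 (sqr_ge0 _); rewrite mulr_ge0 // ltW // wwt_gt0.
  have taum : tau t = m by apply/minn_idPl; exact: ltnW.
  apply: (coordinate_error tau_le CK Copt heps0 heps1 (ltnW hk)).
    rewrite (leq_trans _ (leq_pexp2l _ mr)) // expnS.
    by have := level_large hk heps0 heps1 level; lia.
  by rewrite taum.
- exists tau; split=> // t.
  by rewrite tau_le andbT leq_min m0 hrho.
rewrite powRrM powR_mulrn ?powR_ge0 // -exprMn -/(resolution_bound k eps).
apply: le_trans (_ : (2 ^+ m) ^+ d <= _); last first.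
  by rewrite lerXn2r ?nnegrE ?exprn_ge0 // (le_trans _ mA) ?exprn_ge0.
rewrite card_dep_ffun foldrE big_map big_enum /= natr_prod.
apply: le_trans (_ : \prod_(t < d) 2 ^+ m <= _); last first.
  by rewrite prodr_const card_ord.
apply: ler_prod => t _.
by rewrite ler0n card_ord -natrX ler_nat leq_pexp2l // geq_minl.
Qed.
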